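(* Let $q$ be a complex number with $|q|<1$ and let $N\ge 1$ and $m$ be integers with $0\le m\le N$. Then $$\begin{bmatrix}N\\ m\end{bmatrix}=\sum_{\substack{\alpha_1+\alpha_2+\cdots+\alpha_{N-m}\le m\\ \alpha_1,\alpha_2,\dots,\alpha_{N-m}\in\{0,1,2,\dots,m\}}}q^{\alpha_1+2\alpha_2+3\alpha_3+\cdots+(N-m)\alpha_{N-m}}.$$
   Context: $(q)_n:=\prod_{j=1}^{n}(1-q^j)$ (with $(q)_0=1$), and $\begin{bmatrix}N\\ m\end{bmatrix}:=\frac{(q)_N}{(q)_m(q)_{N-m}}$ for $0\le m\le N$ is the $q$-binomial coefficient. When $m=N$ the sum is over the single empty tuple and equals $1$. Convention $0^0=1$. *)

(* Defs.v *)
From mathcomp Require Import all_boot all_order all_algebra.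

Set Implicit Arguments.
Unset Strict Implicit.
Unset Printing Implicit Defensive.

Import Order.TTheory GRing.Theory Num.Theory.
Local Open Scope ring_scope.

Definition qpoch (F : fieldType) (q : F) (n : nat) : F :=
  \prod_(1 <= j < n.+1) (1 - q ^+ j).

(* Meaningful for m <= N only (N - m is truncated), and when 1 - q ^+ j != 0
   for 1 <= j <= N, which holds as soon as `|q| < 1. *)
Definition qbinom (F : fieldType) (q : F) (N m : nat) : F :=
  qpoch q N / (qpoch q m * qpoch q (N - m)).

(* Main.v *)
Require Import Defs.
From mathcomp Require Import all_boot all_order all_algebra.
From mathcomp Require Import complex reals.
From mathcomp Require Import ring zify.

(** Read a tuple [a] as the partition in which the part [i] (from 1 to
    [k = N - m]) is repeated [a_i] times: the exponent is the integer being
    partitioned, and the constraint on [a] says that there are at most [m]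
    parts.  The right-hand side is thus the generating function of the
    partitions that fit in a [k] by [m] box.

    Both sides satisfy the same Pascal rule
      [G (k+1, s+1) = G (k, s+1) + q^(k+1) * G (k+1, s)]:
    a partition either does not use the largest allowed part [k+1], or loses
    one copy of it ([boxsum_pascal]); for the quotients of q-factorials the rule
    is the identity
      [1 - q^(k+s+2) = (1 - q^(k+1)) + q^(k+1) (1 - q^(s+1))]
    ([qbinom_pascal]).  Both sides are 1 when [k = 0] or [s = 0], so a double
    induction identifies them ([boxsumE]).  As [q] has modulus below 1,
    no power [q^j] with [j > 0] is 1, so the q-factorials are invertible. *)

Set Implicit Arguments.
Unset Strict Implicit.
Unset Printing Implicit Defensive.

Import Order.TTheory GRing.Theory Num.Theory.
Local Open Scope ring_scope.
Local Open Scope complex_scope.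

Section FfunRcons.

Variables (T : finType) (k : nat).

Definition ffun_rcons (b : {ffun 'I_k -> T}) (c : T) : {ffun 'I_k.+1 -> T} :=
  [ffun i => oapp b c (unlift ord_max i)].

Lemma ffun_rcons_max b c : ffun_rcons b c ord_max = c.
Proof. by rewrite ffunE unlift_none. Qed.

Lemma ffun_rcons_lift b c i : ffun_rcons b c (lift ord_max i) = b i.
Proof. by rewrite ffunE liftK. Qed.

Lemma ffun_rcons_widen b c i :
  ffun_rcons b c (widen_ord (leqnSn k) i) = b i.
Proof.
rewrite -(ffun_rcons_lift b c); congr (ffun_rcons b c _).
exact/val_inj/esym/lift_max.
Qed.

Lemma big_ffun_rcons (V : nmodType) (P : pred {ffun 'I_k.+1 -> T})
    (f : {ffun 'I_k.+1 -> T} -> V) :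
  \sum_(a | P a) f a =
  \sum_c \sum_(b | P (ffun_rcons b c)) f (ffun_rcons b c).
Proof.
rewrite pair_big_dep /=.
rewrite (reindex (fun p : T * {ffun 'I_k -> T} => ffun_rcons p.2 p.1)) //=.
exists (fun a => (a ord_max, [ffun i => a (lift ord_max i)])) => [[c b] _|a _] /=.
  congr pair; first exact: ffun_rcons_max.
  by apply/ffunP=> i; rewrite ffunE ffun_rcons_lift.
apply/ffunP=> i; case: (unliftP ord_max i) => [j|] ->.
  by rewrite ffun_rcons_lift ffunE.
exact: ffun_rcons_max.
Qed.

End FfunRcons.

Section BoxSum.

Variables (F : fieldType) (q : F).

(** The bound [M] on the entries is kept apart from the bound [s] on their sum,
    so that [s] can decrease in an induction while the index type stays fixed;
    the value does not depend on [M] as long as [s <= M]. *)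
Definition boxsum (M k s : nat) : F :=
  \sum_(a : {ffun 'I_k -> 'I_M.+1} | (\sum_(i < k) a i <= s)%N)
     q ^+ (\sum_(i < k) i.+1 * a i)%N.

Lemma boxsum0k M s : boxsum M 0 s = 1.
Proof.
rewrite /boxsum (big_pred1 [ffun=> ord0]) ?big_ord0 // => a.
rewrite /= big_ord0 leq0n; apply/esym/eqP/ffunP; by case.
Qed.

Lemma boxsum_recr M k s : (s <= M)%N ->
  boxsum M k.+1 s = \sum_(c < s.+1) q ^+ (k.+1 * c) * boxsum M k (s - c).
Proof.
move=> sM; rewrite /boxsum big_ffun_rcons.
(* Values of the last entry above [s] leave no room for the others. *)
rewrite (big_ord_widen M.+1
  (fun c => q ^+ (k.+1 * c) * boxsum M k (s - c))) // [RHS]big_mkcond /=.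
apply: eq_bigr => c _.
have sumE (b : {ffun 'I_k -> 'I_M.+1}) :
    (\sum_(i < k.+1) ffun_rcons b c i = \sum_(i < k) b i + c)%N.
  rewrite big_ord_recr /= ffun_rcons_max; congr (_ + _)%N.
  by apply: eq_bigr => i _; rewrite ffun_rcons_widen.
have weightE (b : {ffun 'I_k -> 'I_M.+1}) :
    (\sum_(i < k.+1) i.+1 * ffun_rcons b c i
       = k.+1 * c + \sum_(i < k) i.+1 * b i)%N.
  rewrite big_ord_recr /= ffun_rcons_max addnC; congr (_ + _)%N.
  by apply: eq_bigr => i _; rewrite ffun_rcons_widen.
rewrite ltnS; case: leqP => [cs | sc].
  rewrite mulr_sumr; apply: eq_big => [b|b _].
    by rewrite sumE leq_subRL // addnC.
  by rewrite weightE exprD.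
by apply: big1 => b; rewrite sumE => /(leq_trans (leq_addl _ _)); lia.
Qed.

Lemma boxsumk0 M k : boxsum M k 0 = 1.
Proof.
elim: k => [|k IHk]; first exact: boxsum0k.
by rewrite boxsum_recr // big_ord1 muln0 mul1r IHk.
Qed.

(** The terms where the part [k.+1] occurs are, after the removal of one copy
    of it, those of the expansion of [boxsum M k.+1 s]. *)
Lemma boxsum_pascal M k s : (s < M)%N ->
  boxsum M k.+1 s.+1 = boxsum M k s.+1 + q ^+ k.+1 * boxsum M k.+1 s.
Proof.
move=> sM; rewrite boxsum_recr // big_ord_recl muln0 mul1r subn0; congr (_ + _).
rewrite boxsum_recr 1?ltnW // mulr_sumr; apply: eq_bigr => c _.
by rewrite lift0 subSS mulrA -exprD mulnS.
Qed.

Lemma qpochS n : qpoch q n.+1 = qpoch q n * (1 - q ^+ n.+1).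
Proof. by rewrite /qpoch big_nat_recr. Qed.

Hypothesis q_not_root1 : forall n, 1 - q ^+ n.+1 != 0.

Lemma qpoch_neq0 n : qpoch q n != 0.
Proof.
elim: n => [|n IHn]; first by rewrite /qpoch big_geq ?oner_neq0.
by rewrite qpochS mulf_neq0.
Qed.

Lemma qbinomnn n : qbinom q n n = 1.
Proof.
by rewrite /qbinom subnn [qpoch q 0]big_geq // mulr1 divff ?qpoch_neq0.
Qed.

Lemma qbinomn0 n : qbinom q n 0 = 1.
Proof.
by rewrite /qbinom subn0 [qpoch q 0]big_geq // mul1r divff ?qpoch_neq0.
Qed.

Lemma qbinom_pascal k s :
  qbinom q (k.+1 + s.+1) s.+1 =
  qbinom q (k + s.+1) s.+1 + q ^+ k.+1 * qbinom q (k.+1 + s) s.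
Proof.
rewrite /qbinom !addnK addSnnS !addnS !qpochS -addSn -addnS !exprD.
have := (q_not_root1 k, q_not_root1 s, qpoch_neq0 k, qpoch_neq0 s).
move=> [[[k1 s1] pk] ps].
by field; rewrite k1 s1 pk ps.
Qed.

Lemma boxsumE M k s : (s <= M)%N -> boxsum M k s = qbinom q (k + s) s.
Proof.
elim: k s => [|k IHk] s; first by rewrite boxsum0k qbinomnn.
elim: s => [|s IHs] sM; first by rewrite boxsumk0 qbinomn0.
by rewrite boxsum_pascal // qbinom_pascal IHk // IHs // ltnW.
Qed.

End BoxSum.

Lemma norm_lt1_not_root1 (F : numFieldType) (q : F) n :
  `|q| < 1 -> 1 - q ^+ n.+1 != 0.
Proof.
move=> q1; rewrite subr_eq0; apply/eqP => q_root.
have := exprn_ilt1 n.+1 (normr_ge0 q) q1.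
by rewrite -normrX -q_root normr1 ltxx.
Qed.

(* The ordinal i : 'I_(N - m) stands for the index i + 1. *)
Theorem corollary3p2 (R : realType) (q : R[i]) (N m : nat)
    (hq : `|q| < 1) (hN : (1 <= N)%N) (hm : (m <= N)%N) :
  qbinom q N m =
  \sum_(a : {ffun 'I_(N - m) -> 'I_m.+1} | (\sum_(i < N - m) a i <= m)%N)
     q ^+ (\sum_(i < N - m) i.+1 * a i)%N.
Proof.
have := boxsumE (fun n => norm_lt1_not_root1 n hq) (N - m) (leqnn m).
by rewrite subnK // => <-.
Qed.
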